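(* Consider a two-settlement electricity market with the load-serving entity (LSE), the conventional supplier, and an infinite number of virtual traders (i.e. in the limit as the number $N_V$ of virtual traders tends to infinity), and no renewable suppliers. Then at equilibrium the day-ahead market clearing price equals the expected real-time market clearing price: $$p_f^*=\mathbb E[p_s^*],$$ that is, the equilibrium price gap $\mathbb E[p_s^*(t)]-p_f^*(t)$ in the market with $N_V$ virtual traders tends to $0$ as $N_V\to\infty$, for $t\in\mathcal T$.
   Context: Model. $\mathcal T$ is a finite time interval. Demand $\{\tilde D(t):t\in\mathcal T\}$ is a continuous stochastic process with values in $[\underline D,\overline D]$, $\overline D>\underline D\ge 0$; its distribution is known in the day-ahead (DA) market and its realization $D(t)$ becomes known before the real-time (RT) market. In expectations, $D(t)$ denotes the random demand. Time arguments are often suppressed. Conventional supplier: it has a known, binding supply function $C:\mathbb R^+\to\mathbb R^+$ ($\mathbb R^+=[0,\infty)$), with $C(p)=0$ for $p\in[0,\underline p_c]$, and $C$ differentiable, weakly concave and strictly increasing for $p>\underline p_c$. It has no capacity constraint and is not strategic. Virtual (DEC) traders $v\in\mathcal V=\{1,\dots,N_V\}$, $N_V\ge 2$: each submits in the DA market only a differentiable, strictly decreasing bid function $B_v:\mathbb R^+\to\mathbb R^+$; $B_v(p)$ is the quantity it is willing to buy at DA price $p$, and this position is automatically cash settled at the RT price. DA market: the LSE submits a continuous demand curve $D_l=\{D_l(t)\}_{t\in\mathcal T}$; the DA clearing price $p_f^*(t)$ solves $C(p_f^*(t))=D_l(t)+\sum_{v\in\mathcal V}B_v(p_f^*(t))$.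 RT market: the residual demand is $D_r(t)=D(t)-C(p_f^*(t))$. If $D_r(t)>0$, the RT clearing price $p_s^*(t)$ solves $\bar C(p_s^*(t))-C(p_f^*(t))=D_r(t)$, where $\bar C(p)=\max\{C(p),C(p_f^*(t))\}$. If $D_r(t)\le 0$ there is no RT activity and $p_s^*(t)=0$. Equilibrium: a profile $(D_l^*,\mathbb B^* )$ such that, for all $t\in\mathcal T$, (a) $D_l^*$ minimizes the LSE's expected cost $p_f^*(t)D_l(t)+\mathbb E[(D(t)-D_l(t))^+p_s^*(t)]$ given $\mathbb B^*$; (b) for each $v$, $B_v^*$ is continuous, decreasing and maximizes $\big(\mathbb E[p_s^*(t)]-p_f^*(t)\big)B_v(p_f^*(t))$ over feasible $B_v$, given $D_l^*$ and the other traders' bid functions. *)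

(* Defs.v *)
(* Functions on [0, +oo[ are total functions R -> R of
   which only the restriction to nonnegative prices is ever constrained. *)
From HB Require Import structures.
From mathcomp Require Import all_boot all_order all_algebra.
From mathcomp Require Import all_classical all_reals all_analysis.
Set Implicit Arguments.
Unset Strict Implicit.
Unset Printing Implicit Defensive.
Import Order.TTheory GRing.Theory Num.Theory numFieldNormedType.Exports.
Local Open Scope classical_set_scope.
Local Open Scope ring_scope.

(* No continuity at [pc] is required. [cs_unlimited] renders the absence of a
   capacity constraint: any quantity is supplied at a high enough price. *)
Record conventional_supply (R : realType) (pc : R) (C : R -> R) : Prop := {
  cs_pc_ge0 : 0 <= pc;
  cs_ge0 : forall p, 0 <= p -> 0 <= C p;
  cs_eq0 : forall p, 0 <= p <= pc -> C p = 0;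
  cs_derivable : forall p, pc < p -> derivable C p 1;
  cs_concave : convex_function `]pc, +oo[ (fun p => - C p);
  cs_increasing : forall p q, pc < p -> p < q -> C p < C q;
  cs_unlimited : forall q, exists2 p, 0 <= p & q <= C p }.

(* Differentiability on [0, +oo[ is one-sided at 0. *)
Record feasible_bid (R : realType) (b : R -> R) : Prop := {
  fb_ge0 : forall p, 0 <= p -> 0 <= b p;
  fb_derivable : forall p, 0 < p -> derivable b p 1;
  fb_derivable0 : cvg (h^-1 * (b h - b 0) @[h --> 0^'+]);
  fb_decreasing : forall p q, 0 <= p -> p < q -> b q < b p }.

Definition da_clearing (R : realType) (C : R -> R) (n : nat)
    (Dl : R) (B : 'I_n -> R -> R) (pf : R) : Prop :=
  0 <= pf /\ C pf = Dl + \sum_(v < n) B v pf.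

Definition residual_demand (R : realType) (C : R -> R) (d pf : R) : R :=
  d - C pf.

Definition rt_supply (R : realType) (C : R -> R) (pf p : R) : R :=
  Num.max (C p) (C pf).

Definition rt_clearing (R : realType) (C : R -> R) (d pf ps : R) : Prop :=
  if 0 < residual_demand C d pf
  then 0 <= ps /\ rt_supply C pf ps - C pf = residual_demand C d pf
  else ps = 0.

(* The prices [pf] and [ps] that result, at one time, from the LSE's quantity
   [Dl] and the bids [B] when the random demand is [D]. *)
Definition market_outcome (R : realType) (C : R -> R) (Omega : Type)
    (D : Omega -> R) (n : nat) (Dl : R) (B : 'I_n -> R -> R)
    (pf : R) (ps : Omega -> R) : Prop :=
  da_clearing C Dl B pf /\ forall w, rt_clearing C (D w) pf (ps w).

Section payoffs.
Context d (Omega : measurableType d) (R : realType) (P : probability Omega R).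
Local Open Scope ereal_scope.

(* Random variables here are bounded, so that these extended reals are finite
   at every outcome of a market with bounded demand. *)
Definition price_gap (pf : R) (ps : Omega -> R) : \bar R :=
  'E_P[ps] - pf%:E.

Definition lse_cost (D : Omega -> R) (Dl pf : R) (ps : Omega -> R) : \bar R :=
  (pf * Dl)%:E + 'E_P[(fun w => Num.max (D w - Dl) 0 * ps w)%R].

Definition trader_profit (b : R -> R) (pf : R) (ps : Omega -> R) : \bar R :=
  price_gap pf ps * (b pf)%:E.

End payoffs.

(* [pf] and [ps] are the equilibrium prices. A deviation changes the prices
   through both clearing conditions; deviations after which the market does
   not clear are not admissible. *)
Record equilibrium d (Omega : measurableType d) (R : realType)
    (P : probability Omega R) (T : set R) (C : R -> R) (D : R -> Omega -> R)
    (n : nat) (Dl : R -> R) (B : 'I_n -> R -> R)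
    (pf : R -> R) (ps : R -> Omega -> R) : Prop := {
  eq_demand_curve : {within T, continuous Dl};
  eq_bids : forall v, feasible_bid (B v);
  eq_outcome : forall t, T t ->
    market_outcome C (D t) (Dl t) B (pf t) (ps t);
  eq_lse : forall t, T t ->
    forall (Dl' : R -> R) (pf' : R) (ps' : Omega -> R),
      {within T, continuous Dl'} ->
      market_outcome C (D t) (Dl' t) B pf' ps' ->
      (lse_cost P (D t) (Dl t) (pf t) (ps t)
         <= lse_cost P (D t) (Dl' t) pf' ps')%E;
  eq_trader : forall t, T t ->
    forall (v : 'I_n) (b : R -> R) (pf' : R) (ps' : Omega -> R),
      feasible_bid b ->
      market_outcome C (D t) (Dl t)
        (fun u => if u == v then b else B u) pf' ps' ->
      (trader_profit P b pf' ps'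
         <= trader_profit P (B v) (pf t) (ps t))%E }.

(* Main.v *)
Require Import Defs.
From HB Require Import structures.
From mathcomp Require Import all_boot all_order all_algebra.
From mathcomp Require Import all_classical all_reals all_analysis.
From mathcomp Require Import measurable_realfun ring lra.
Import Order.TTheory GRing.Theory Num.Theory numFieldNormedType.Exports.
Local Open Scope classical_set_scope.
Local Open Scope ring_scope.
Set Implicit Arguments.
Unset Strict Implicit.

(** Fix a time, and let [pf], [ps] be the equilibrium prices in a market with
    [n] traders, [S p] the total virtual demand at price [p], [L] the quantity
    of the LSE, so that [C pf = L + S pf], and [g = E ps - pf] the price gap.
    The gap lies between [0] and [K / n.+1] for a constant [K] that depends
    only on [C] and on the bound on demand; the proposition follows by
    squeezing. Both bounds come from deviations to a nearby DA price [p]: an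
    agent can move the clearing price to [p] by claiming the residual quantity
    at [p], a trader by rescaling its own bid, the LSE by resetting its
    quantity.

    Lower bound ([price_gap_ge0]). Every trader holds a positive position, so
    it loses money when [g < 0]. Lowering the DA price a little shrinks the
    position and widens the set of demands met in real time, which raises
    [E ps - p]; the loss is reduced.

    Upper bound ([price_gap_le]). Let the DA price rise to [p > pf]. In real
    time this only cancels the trades at prices at most [p], so that the RT
    price becomes [ps' w = if p < ps w then ps w else 0]. Let [g'] be the new
    gap. Summing over the traders the statement that none of them gains,
<<
      g' * (n * (C p - C pf + S pf - S p) + S p) <= g * S pf,
>>
    and the LSE does not gain either,
<<
      g' * (C p - S p) + C pf * (E ps - E ps') <= g * (C pf - S pf).
>>
    The drop [E ps - E ps'] can be arbitrarily steep where demand concentrates,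
    and then neither statement alone bounds the gap. Their sum does, because
    the drop cancels up to a multiple of [p - pf]:
<<
      g' * (n.+1 * (C p - C pf) + n * (S pf - S p)) <= C pf * (p - pf).
>>
    RT prices never exceed some [Q], so concavity bounds the slope of [C]
    between [pf] and [p] from below by its slope between [Q] and [Q + 1], and
    [g'] is at most [K / n.+1] with [K = C Q / (C (Q + 1) - C Q)]. Letting [p]
    decrease to [pf] gives the same bound for [g], as then [E ps'] tends to
    [E ps] by dominated convergence. *)

(** * The supply curve *)

Section supply.
Context {R : realType} {pc : R} {C : R -> R}.
Context (CS : conventional_supply pc C).
Implicit Types p q r s : R.

Lemma supply_le p q : 0 <= p -> p <= q -> C p <= C q.
Proof.
move=> p0; rewrite le_eqVlt => /predU1P[->//|pq].
have q0 : 0 <= q by lra.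
have [ppc|pcp] := leP p pc; last exact/ltW/(cs_increasing CS).
by rewrite (cs_eq0 CS) ?p0//; exact: (cs_ge0 CS).
Qed.

Lemma supply_lt p q : 0 <= p -> p < q -> 0 < C q -> C p < C q.
Proof.
move=> p0 pq; have [ppc|pcp] := leP p pc.
  by rewrite (cs_eq0 CS (p := p)) ?p0.
by move=> _; exact: (cs_increasing CS).
Qed.

Lemma supply_lt_price p q : 0 <= q -> C p < C q -> p < q.
Proof.
by move=> q0 Cpq; rewrite ltNge; apply/negP => /(supply_le q0); lra.
Qed.

(** The quotients of the chord inequality are cleared so that it can be used
    as a linear inequality in the values of [C]. *)
Lemma supply_chord p q r : pc < p -> p < q -> q < r ->
  (r - q) * C p + (q - p) * C r <= (r - p) * C q.
Proof.
move=> pcp pq qr.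
set k := (r - q) / (r - p).
have k01 : 0 <= k <= 1 by rewrite /k divr_ge0 ?ler_pdivrMr /=; lra.
have pA : p \in `]pc, +oo[%classic by rewrite inE/= in_itv/= pcp.
have rA : r \in `]pc, +oo[%classic by rewrite inE/= in_itv/= andbT; lra.
have H : - C (k * p + (1 - k) * r) <= k * - C p + (1 - k) * - C r :=
  cs_concave CS (Itv01 (andP k01).1 (andP k01).2) pA rA.
have kq : k * p + (1 - k) * r = q by rewrite /k; field; lra.
have rp : 0 < r - p by lra.
have krp : k * (r - p) = r - q by rewrite /k; field; lra.
rewrite kq in H; have := ler_wpM2l (ltW rp) H.
have -> : (r - p) * (k * - C p + (1 - k) * - C r) =
  - (k * (r - p) * C p + (r - p - k * (r - p)) * C r) by ring.
rewrite krp; lra.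
Qed.

(** Slopes of a concave function decrease: the chord over [p, q] is at least as
    steep as the chord over [r, s]. *)
Lemma supply_slope_le p q r s : pc < p -> p < q -> q < r -> r < s ->
  (q - p) * (C s - C r) <= (s - r) * (C q - C p).
Proof.
move=> pcp pq qr rs.
have H1 := supply_chord pcp pq (lt_trans qr rs).
have H2 := supply_chord (lt_trans pcp pq) qr rs.
have sq : 0 < s - q by lra.
rewrite -(ler_pM2l sq).
have := ler_wpM2l (ltW (_ : 0 < q - p)) H2.
have := ler_wpM2l (ltW (_ : 0 < s - r)) H1.
move=> /(_ ltac:(lra)) H3 /(_ ltac:(lra)) H4; lra.
Qed.

(** * Real-time clearing *)

(** Real-time clearing depends on the DA price only through the threshold
    [C pf]: demand above it is priced on the supply curve itself. *)
Lemma rt_clearingE (x pf ps : R) : rt_clearing C x pf ps <->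
  (if C pf < x then 0 <= ps /\ C ps = x else ps = 0).
Proof.
rewrite /rt_clearing /residual_demand /rt_supply subr_gt0.
case: ifPn => // Cx; split=> -[ps0 H]; split=> //.
  by move: H; case: (leP (C ps) (C pf)) => ?; lra.
by rewrite max_l; lra.
Qed.

Implicit Types x pf ps : R.

Lemma rt_price_ge0 x pf ps : rt_clearing C x pf ps -> 0 <= ps.
Proof. by move/rt_clearingE; case: ifP => _ => [[]|->]. Qed.

Lemma rt_price_supply x pf ps : rt_clearing C x pf ps -> 0 < ps -> C ps = x.
Proof. by move/rt_clearingE; case: ifP => _ => [[]|->]; rewrite ?ltxx. Qed.

(** Above the DA price, the level sets of the RT price are level sets of demand;
    this gives both its measurability and its response to a higher DA price. *)
Lemma rt_price_gt x pf ps p : 0 <= pf -> rt_clearing C x pf ps -> pf <= p ->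
  (p < ps) = (C p < x).
Proof.
move=> pf0 cl pfp; have p0 : 0 <= p by lra.
have Cp := supply_le pf0 pfp.
move/rt_clearingE : cl; case: ifPn => [pfx [ps0 Cps]|].
  rewrite -Cps.
  apply/idP/idP => [pps|]; last exact: supply_lt_price.
  apply: (supply_lt p0 pps); have := cs_ge0 CS pf0.
  lra.
rewrite -leNgt => xC ->; apply/idP/idP => [|?]; lra.
Qed.

Lemma rt_price_le x pf ps q : rt_clearing C x pf ps -> 0 <= q -> x < C q ->
  ps <= q.
Proof.
move=> cl q0 xq; rewrite leNgt; apply/negP => qps.
have := supply_le q0 (ltW qps); rewrite (rt_price_supply cl); lra.
Qed.

(** Raising the DA price to [p] brings forward all supply at prices up to [p], so
    that the RT trades at those prices disappear and the others are unchanged. *)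
Lemma rt_clearing_raise x pf ps p : 0 <= pf -> rt_clearing C x pf ps ->
  pf <= p -> rt_clearing C x p (if p < ps then ps else 0).
Proof.
move=> pf0 cl pfp; apply/rt_clearingE; rewrite -(rt_price_gt pf0 cl pfp).
case: (boolP (p < ps)) => // pps; split; first exact: rt_price_ge0 cl.
by apply: (rt_price_supply cl); lra.
Qed.

(** The side condition keeps [C] continuous between [p] and [pf]: at [pc] the
    supply may jump, and then demands inside the jump would not clear. Demands
    between [C p] and [C pf] acquire a positive RT price, by the intermediate
    value theorem. *)
Lemma rt_clearing_lower x pf ps p : rt_clearing C x pf ps -> 0 <= p ->
  p <= pf -> pf <= pc \/ pc < p ->
  exists2 ps', rt_clearing C x p ps' & ps <= ps'.
Proof.
move=> cl p0 ppf [pfpc|pcp].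
  have [pfge0 ppc] : 0 <= pf /\ p <= pc by split; lra.
  exists ps => //; apply/rt_clearingE; move/rt_clearingE : cl.
  have -> : C p = 0 by apply: (cs_eq0 CS); rewrite p0.
  by have -> : C pf = 0 by apply: (cs_eq0 CS); rewrite pfge0.
have Cp := supply_le p0 ppf.
have [Cpx|xCp] := ltP (C p) x; last first.
  have ps0 : ps = 0 by move/rt_clearingE : cl; rewrite ltNge (le_trans xCp Cp).
  by exists 0; rewrite ?ps0//; apply/rt_clearingE; rewrite ltNge xCp.
have [Cpfx|xCpf] := ltP (C pf) x.
  exists ps => //; apply/rt_clearingE; move/rt_clearingE : cl.
  by rewrite Cpfx Cpx.
have cC : {within `[p, pf], continuous C}.
  apply: derivable_within_continuous => y; rewrite in_itv/= => /andP[py _].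
  by apply: (cs_derivable CS); lra.
have [|y] := @IVT _ C p pf x ppf cC; first by rewrite min_l ?max_r ?(ltW Cpx).
rewrite in_itv/= => /andP[py _] Cy; exists y.
  by apply/rt_clearingE; rewrite Cpx; split => //; lra.
move/rt_clearingE : cl; rewrite ltNge xCpf /= => ->; lra.
Qed.

End supply.

Section rt_price_measurable.
Context {d : measure_display} {Omega : measurableType d} {R : realType}.
Context {pc : R} {C : R -> R} (CS : conventional_supply pc C).
Context {X ps : Omega -> R} {pf : R}.

Lemma rt_price_measurable : measurable_fun setT X -> 0 <= pf ->
  (forall w, rt_clearing C (X w) pf (ps w)) -> measurable_fun setT ps.
Proof.
move=> mX pf0 cl mT.
apply: (measurability _ (RGenOInfty.measurableE R)) => //.
move=> /= _ [_ [a ->] <-]; apply: measurableI => //.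
(* RT prices avoid the range between 0 and [pf], whence the threshold
   [Num.max a pf] when [0 <= a]. *)
have [a0|a0] := leP 0 a; last first.
  rewrite [X in measurable X](_ : _ = setT)//.
  apply/seteqP; split => w //= _; rewrite in_itv/= andbT.
  exact: lt_le_trans a0 (rt_price_ge0 (cl w)).
rewrite [X in measurable X](_ : _ = X @^-1` `]C (Num.max a pf), +oo[%classic).
  by rewrite -[X in measurable X]setTI; apply: mX => //; exact: measurable_itv.
have E w : (a < ps w) = (C (Num.max a pf) < X w).
  rewrite -(rt_price_gt CS pf0 (cl w)) ?le_max ?lexx ?orbT//.
  rewrite gt_max; apply/idP/andP => [aps|[]//]; split => //.
  rewrite (rt_price_gt CS pf0 (cl w))//.
  move/rt_clearingE : (cl w); case: ifPn => // _ ps0; lra.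
by apply/seteqP; split => w /=; rewrite !in_itv/= !andbT E.
Qed.

End rt_price_measurable.

(** * Equilibrium at one time *)

Section spot.
Context {d : measure_display} {Omega : measurableType d} {R : realType}.
Context {P : probability Omega R}.
Implicit Types f X : Omega -> R.

Lemma bounded_rv_integrable f (M : R) : measurable_fun setT f ->
  (forall w, `|f w| <= M) -> P.-integrable setT (EFin \o f).
Proof.
move=> mf fM; apply: measurable_bounded_integrable => //.
  exact: fin_num_fun_lty.
exists M; split => [|N MN w _ /=]; first exact: num_real.
exact: le_trans (fM w) (ltW MN).
Qed.

Lemma expectation_Rintegral f : P.-integrable setT (EFin \o f) ->
  ('E_P[f])%E = (\int[P]_w f w)%:E.
Proof. by move=> intf; rewrite unlock fineK// integrable_fin_num. Qed.

(** The equilibrium conditions at a single time, where the LSE chooses a number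
    instead of a demand curve. *)
Record spot_equilibrium (C : R -> R) X (n : nat) (L : R) (B : 'I_n -> R -> R)
    (pf : R) (ps : Omega -> R) : Prop := {
  se_bids : forall v, feasible_bid (B v);
  se_outcome : market_outcome C X L B pf ps;
  se_lse : forall L' pf' ps', market_outcome C X L' B pf' ps' ->
    (lse_cost P X L pf ps <= lse_cost P X L' pf' ps')%E;
  se_trader : forall v b pf' ps', feasible_bid b ->
    market_outcome C X L (fun u => if u == v then b else B u) pf' ps' ->
    (trader_profit P b pf' ps' <= trader_profit P (B v) pf ps)%E }.

(** A deviation of the LSE at one time extends to the constant demand curve,
    which is continuous. *)
Lemma equilibrium_spot (T : set R) (C : R -> R) (D : R -> Omega -> R)
    (n : nat) (Dl : R -> R) (B : 'I_n -> R -> R) (pf : R -> R)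
    (ps : R -> Omega -> R) (t : R) :
  equilibrium P T C D Dl B pf ps -> T t ->
  spot_equilibrium C (D t) (Dl t) B (pf t) (ps t).
Proof.
move=> [_ fB out lse trader] Tt; split => //; first exact: out.
- move=> L' pf' ps' out'; apply: (lse t Tt (cst L')) => //.
  by apply: continuous_subspaceT => x; exact: cvg_cst.
- by move=> v b pf' ps'; exact: trader.
Qed.

Lemma feasible_bid_gt0 (b : R -> R) (p : R) :
  feasible_bid b -> 0 <= p -> 0 < b p.
Proof.
move=> fb p0; have p10 : 0 <= p + 1 by lra.
have : p < p + 1 by rewrite ltrDl.
by move/(fb_decreasing fb p0); apply: le_lt_trans; exact: (fb_ge0 fb).
Qed.

(** A trader reaches any positive quantity at a given price by rescaling its
    own bid, so that no other feasible bid has to be constructed. *)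
Lemma feasible_bid_scale (b : R -> R) (k : R) :
  0 < k -> feasible_bid b -> feasible_bid (fun p => k * b p).
Proof.
move=> k0 fb; split.
- by move=> p p0; rewrite mulr_ge0 ?(ltW k0)//; exact: (fb_ge0 fb).
- by move=> p p0; apply: derivableZ; exact: (fb_derivable fb).
- rewrite [X in cvg (X @ _)](_ : _ = fun h => k * (h^-1 * (b h - b 0))).
    by apply: is_cvgMl_tmp; exact: (fb_derivable0 fb).
  by apply/funext => h; ring.
- by move=> p q p0 pq; rewrite ltr_pM2l//; exact: (fb_decreasing fb).
Qed.

Context {pc : R} {C : R -> R} (CS : conventional_supply pc C).
Context {X : Omega -> R} (mX : measurable_fun setT X).
Context {xmax Q : R} (X_bounds : forall w, 0 <= X w <= xmax).
Context (pcQ : pc < Q) (xmaxQ : xmax < C Q).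

Lemma rt_price_bounds p (ps : Omega -> R) w : 0 <= p ->
  rt_clearing C (X w) p (ps w) -> 0 <= ps w <= Q.
Proof.
move=> p0 cl; rewrite (rt_price_ge0 cl)/=.
apply: (rt_price_le CS cl); first by have := cs_pc_ge0 CS; have := pcQ; lra.
by apply: le_lt_trans xmaxQ; have /andP[] := X_bounds w.
Qed.

Section outcome.
Context {p : R} {ps : Omega -> R}.
Context (p0 : 0 <= p) (cl : forall w, rt_clearing C (X w) p (ps w)).

Lemma rt_price_integrable : P.-integrable setT (EFin \o ps).
Proof.
apply: (@bounded_rv_integrable _ Q); first exact (rt_price_measurable CS mX p0 cl).
by move=> w; have /andP[ps0 psQ] := rt_price_bounds p0 (cl w); rewrite ger0_norm.
Qed.

Lemma rt_revenue_integrable : P.-integrable setT (EFin \o (fun w => X w * ps w)).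
Proof.
apply: (@bounded_rv_integrable _ (xmax * Q)).
  by apply: measurable_funM => //; exact (rt_price_measurable CS mX p0 cl).
move=> w; have /andP[ps0 psQ] := rt_price_bounds p0 (cl w).
have /andP[x0 xx] := X_bounds w.
by rewrite ger0_norm ?mulr_ge0// ler_pM.
Qed.

Lemma price_gapE : price_gap P p ps = (\int[P]_w ps w - p)%:E.
Proof.
by rewrite /price_gap expectation_Rintegral//; exact: rt_price_integrable.
Qed.

(** When the LSE buys at most the cleared supply, real-time trade occurs only if
    demand exceeds [C p], hence [L], and the positive part can be dropped: the
    cost is affine in [L] with slope minus the price gap. *)
Lemma lse_costE (L : R) : L <= C p -> lse_cost P X L p ps =
  (\int[P]_w (X w * ps w) - (\int[P]_w ps w - p) * L)%:E.
Proof.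
move=> LC; rewrite /lse_cost.
have E : (fun w => Num.max (X w - L) 0 * ps w) = (fun w => X w * ps w - L * ps w).
  apply/funext => w; have := rt_price_ge0 (cl w); rewrite le_eqVlt.
  case/predU1P => [<-|ps0]; first by rewrite !mulr0 subr0.
  have Cx : C p < X w.
    rewrite ltNge; apply/negP => xC; move/rt_clearingE : (cl w).
    by rewrite ltNge xC /=; lra.
  by rewrite max_l -?mulrBl//; lra.
have iL : P.-integrable setT (EFin \o (fun w => L * ps w)).
  have := integrableZl measurableT L rt_price_integrable.
  by apply: eq_integrable => // w _ /=; rewrite EFinM.
have iB : P.-integrable setT (EFin \o (fun w => X w * ps w - L * ps w)).
  have := integrableB measurableT rt_revenue_integrable iL.
  by apply: eq_integrable => // w _ /=; rewrite EFinB.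
rewrite E expectation_Rintegral// -EFinD; congr EFin.
rewrite RintegralB//; last exact: rt_revenue_integrable.
rewrite RintegralZl//; last exact: rt_price_integrable.
by ring.
Qed.

End outcome.

(** * Deviations from equilibrium *)

Section deviations.
Context {n : nat} {L : R} {B : 'I_n -> R -> R} {pf : R} {ps : Omega -> R}.
Context (SE : spot_equilibrium C X L B pf ps).
Local Notation S p := (\sum_(u < n) B u p).

Let pf0 : 0 <= pf. Proof. by case: (se_outcome SE) => -[]. Qed.
Let cl w : rt_clearing C (X w) pf (ps w). Proof. by case: (se_outcome SE). Qed.
Let LE : L = C pf - S pf.
Proof. by case: (se_outcome SE) => -[_ ->] _; rewrite addrK. Qed.

Lemma virtual_demand_ge0 p : 0 <= p -> 0 <= S p.
Proof. by move=> ?; apply: sumr_ge0 => u _; exact: fb_ge0 (se_bids SE u) _ _. Qed.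

(** The quantity [C p - L - (S p - B v p)] is the residual supply at [p] that the
    other agents leave to [v]. By claiming it, [v] makes [p] the DA price. *)
Lemma trader_deviation v p (ps' : Omega -> R) : 0 <= p ->
  (forall w, rt_clearing C (X w) p (ps' w)) ->
  0 < C p - L - (S p - B v p) ->
  (\int[P]_w ps' w - p) * (C p - L - (S p - B v p)) <=
  (\int[P]_w ps w - pf) * B v pf.
Proof.
move=> p0 cl'; set s := C p - L - _ => s0.
have bv0 := feasible_bid_gt0 (se_bids SE v) p0.
pose b q := s / B v p * B v q.
have bp : b p = s by rewrite /b divfK// gt_eqF.
have fb : feasible_bid b.
  by apply: feasible_bid_scale; [rewrite divr_gt0|exact: (se_bids SE)].
have out : market_outcome C X L (fun u => if u == v then b else B u) p ps'.
  split => //; split => //; rewrite (bigD1 v)//= eqxx bp.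
  rewrite (eq_bigr (fun u => B u p)); last by move=> u /negbTE ->.
  by rewrite /s [S p](bigD1 v)//=; ring.
have := se_trader SE fb out.
by rewrite /trader_profit !price_gapE// -!EFinM lee_fin bp.
Qed.

(** The LSE makes [p] the DA price by claiming what the traders leave of the
    supply at [p]. *)
Lemma lse_deviation p (ps' : Omega -> R) : 0 <= p ->
  (forall w, rt_clearing C (X w) p (ps' w)) ->
  \int[P]_w (X w * ps w) - (\int[P]_w ps w - pf) * L <=
  \int[P]_w (X w * ps' w) - (\int[P]_w ps' w - p) * (C p - S p).
Proof.
move=> p0 cl'.
have out : market_outcome C X (C p - S p) B p ps'.
  by split => //; split => //; rewrite subrK.
have := se_lse SE out.
have LC : C p - S p <= C p by rewrite gerBl virtual_demand_ge0.
have LC0 : L <= C pf by rewrite LE gerBl virtual_demand_ge0.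
by rewrite (lse_costE p0 cl' LC) (lse_costE pf0 cl LC0) lee_fin.
Qed.

(** At a negative gap the trader [v] loses on a positive position. At a DA price
    slightly below [pf], the gap is larger and the residual supply smaller but,
    by continuity at [pf], still positive: [v] loses less. If [pf = 0] the gap is
    the mean of a nonnegative price. *)
Lemma price_gap_ge0 (v : 'I_n) : 0 <= \int[P]_w ps w - pf.
Proof.
rewrite leNgt; apply/negP => g0.
have G0 : 0 <= \int[P]_w ps w.
  by apply: Rintegral_ge0 => w _; exact: rt_price_ge0 (cl w).
have pfgt0 : 0 < pf by lra.
have bv0 := feasible_bid_gt0 (se_bids SE v) pf0.
(* The residual supply of [v]; it equals its own bid at [pf]. *)
pose s p := C p - L - (S p - B v p).
have s_cvg : s p @[p --> pf^'-] --> s pf.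
  have cB u : B u p @[p --> pf^'-] --> B u pf.
    apply: cvg_at_left_filter; apply: differentiable_continuous.
    by apply/derivable1_diffP; exact: fb_derivable (se_bids SE u) _ pfgt0.
  (* Left continuity holds even at [pc], below which [C] vanishes. *)
  have cC : C p @[p --> pf^'-] --> C pf.
    have [pfpc|pcpf] := leP pf pc; last first.
      apply: cvg_at_left_filter; apply: differentiable_continuous.
      by apply/derivable1_diffP; exact: cs_derivable CS _ pcpf.
    apply: cvg_near_cst; near=> p.
    have ppf : p < pf by [].
    have p0 : 0 < p by near: p; apply: nbhs_left_gt.
    by rewrite !(cs_eq0 CS)//; lra.
  apply: cvgB; first by apply: cvgB => //; exact: cvg_cst.
  by apply: cvgB => //; apply: cvg_big => //; exact: add_continuous.
have spf : s pf = B v pf by rewrite /s LE; ring.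
have s_gt0 : \forall p \near pf^'-, 0 < s p.
  by apply: (cvgr_gt (s pf)) => //; rewrite spf.
have pc_lt : \forall p \near pf^'-, pf <= pc \/ pc < p.
  have [pfpc|pcpf] := leP pf pc; first by apply: nearW => p; left.
  by near=> p; right; near: p; exact: nbhs_left_gt.
have : \forall p \near pf^'-, [/\ 0 < s p, 0 < p, p < pf & pf <= pc \/ pc < p].
  near=> p; split; near: p => //; first exact: nbhs_left_gt.
  exact: nbhs_left_lt.
move=> /(@filter_ex _ _ (at_left_proper_filter pf))[p] [sp0 /ltW p0 ppf pcp].
have /choice[ps' cl'] w : exists y, rt_clearing C (X w) p y /\ ps w <= y.
  have [y ? ?] := rt_clearing_lower CS (cl w) p0 (ltW ppf) pcp.
  by exists y.
have cl1 w : rt_clearing C (X w) p (ps' w) by case: (cl' w).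
have Gle : \int[P]_w ps w <= \int[P]_w ps' w.
  apply: le_Rintegral => //; first exact: rt_price_integrable pf0 cl.
    exact: rt_price_integrable p0 cl1.
  by move=> w _; case: (cl' w).
have := trader_deviation p0 cl1 sp0; rewrite -/(s p).
have sb : s p <= B v pf.
  rewrite -spf /s.
  have := supply_le CS p0 (ltW ppf).
  have : \sum_(u < n | u != v) B u pf <= \sum_(u < n | u != v) B u p.
    by apply: ler_sum => u _; apply/ltW/(fb_decreasing (se_bids SE u)).
  by rewrite [S p](bigD1 v)// [S pf](bigD1 v)//=; lra.
nra.
Unshelve. all: by end_near.
Qed.

Section raise.
Context {p : R} (pfp : pf < p).
Let ps' w := if p < ps w then ps w else 0.
Let p0 : 0 <= p. Proof. exact: le_trans pf0 (ltW pfp). Qed.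
Let cl' w : rt_clearing C (X w) p (ps' w).
Proof. exact (rt_clearing_raise CS pf0 (cl w) (ltW pfp)). Qed.
Let G := \int[P]_w ps w.
Let G' := \int[P]_w ps' w.

Lemma traders_raise :
  (G' - p) * (n%:R * (C p - C pf + (S pf - S p)) + S p) <= (G - pf) * S pf.
Proof.
have Cp := supply_le CS pf0 (ltW pfp).
have E : n%:R * (C p - C pf + (S pf - S p)) + S p =
    \sum_(v < n) (C p - L - (S p - B v p)).
  rewrite [RHS](eq_bigr (fun v => (C p - C pf + (S pf - S p)) + B v p)).
    by rewrite big_split/= sumr_const card_ord mulr_natl.
  by move=> v _; rewrite LE; ring.
rewrite E !mulr_sumr; apply: ler_sum => v _; apply: trader_deviation => //.
have := feasible_bid_gt0 (se_bids SE v) pf0.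
have : \sum_(u < n | u != v) B u p <= \sum_(u < n | u != v) B u pf.
  by apply: ler_sum => u _; apply/ltW/(fb_decreasing (se_bids SE u)).
by rewrite LE [S p](bigD1 v)// [S pf](bigD1 v)//=; lra.
Qed.

(** Demand exceeds [C pf] in every RT trade that disappears, so the mean of
    [X * ps] falls by at least [C pf] times the fall of the mean of [ps]. *)
Lemma lse_raise :
  (G' - p) * (C p - S p) + C pf * (G - G') <= (G - pf) * (C pf - S pf).
Proof.
have := lse_deviation p0 cl'; rewrite -/G -/G' LE.
have i1 := rt_revenue_integrable pf0 cl.
have i1' := rt_revenue_integrable p0 cl'.
have i2 := rt_price_integrable pf0 cl.
have i2' := rt_price_integrable p0 cl'.
have iB : P.-integrable setT (EFin \o (fun w => ps w - ps' w)).
  have := integrableB measurableT i2 i2'.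
  by apply: eq_integrable => // w _ /=; rewrite EFinB.
have iBX : P.-integrable setT (EFin \o (fun w => X w * ps w - X w * ps' w)).
  have := integrableB measurableT i1 i1'.
  by apply: eq_integrable => // w _ /=; rewrite EFinB.
have iZ : P.-integrable setT (EFin \o (fun w => C pf * (ps w - ps' w))).
  have := integrableZl measurableT (C pf) iB.
  by apply: eq_integrable => // w _ /=; rewrite EFinM.
have : C pf * (G - G') <=
    \int[P]_w (X w * ps w) - \int[P]_w (X w * ps' w).
  rewrite /G /G' -RintegralB// -RintegralB// -RintegralZl//.
  apply: le_Rintegral => // w _; rewrite -mulrBr /ps'.
  case: ifPn => pps; first by rewrite subrr !mulr0.
  rewrite subr0; have := rt_price_ge0 (cl w); rewrite le_eqVlt.
  case/predU1P => [<-|psgt0]; first by rewrite !mulr0.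
  apply: ler_wpM2r; first exact: ltW.
  rewrite leNgt; apply/negP => xC; move/rt_clearingE : (cl w).
  by rewrite ltNge (ltW xC)/=; lra.
lra.
Qed.

(** In the sum of [traders_raise] and [lse_raise] both [G] and [G'] occur with
    coefficient [C pf] on the two sides and cancel there, which removes the
    effect of the distribution of demand. *)
Lemma joint_raise :
  (G' - p) * (n.+1%:R * (C p - C pf) + n%:R * (S pf - S p)) <=
  C pf * (p - pf).
Proof. by have := traders_raise; have := lse_raise; rewrite -natr1; lra. Qed.

(** If [pf <= pc] then [C pf = 0], and [joint_raise] leaves no room for a positive
    gap at [p], as the virtual demand strictly decreases. Otherwise a positive
    gap forces [p < Q], and the slope of [C] on the left of [Q] is at least
    [C (Q + 1) - C Q]. *)
Lemma raised_gap_le : (0 < n)%N ->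
  G' - p <= C Q / (C (Q + 1) - C Q) / n.+1%:R.
Proof.
move=> n0.
have Q0 : 0 <= Q by have := cs_pc_ge0 CS; have := pcQ; lra.
have dp : 0 < p - pf by rewrite subr_gt0.
have CQ : 0 < C (Q + 1) - C Q.
  by rewrite subr_gt0; apply: (cs_increasing CS) => //; rewrite ltrDl.
have n1 : 0 < n%:R :> R by rewrite ltr0n.
have n2 : 0 < n.+1%:R :> R by rewrite ltr0n.
have [g0|g0] := leP (G' - p) 0.
  apply: (le_trans g0); rewrite divr_ge0 ?(ltW n2)// divr_ge0 ?(ltW CQ)//.
  exact: (cs_ge0 CS).
rewrite -mulrA.
have G'Q : G' <= Q.
  have <- : \int[P]_(w in setT) Q = Q.
    by rewrite Rintegral_cst//= probability_setT mulr1.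
  apply: le_Rintegral => //; first exact: rt_price_integrable p0 cl'.
    by apply: (@bounded_rv_integrable _ Q) => // w; rewrite ger0_norm.
  by move=> w _; have /andP[] := rt_price_bounds p0 (cl' w).
have J := joint_raise.
have dC := supply_le CS pf0 (ltW pfp).
have dS : 0 < S pf - S p.
  rewrite subr_gt0; apply: ltr_sum => [|u _].
    by apply/hasP; exists (Ordinal n0); rewrite ?mem_index_enum.
  exact: (fb_decreasing (se_bids SE u)).
have [pfpc|pcpf] := leP pf pc.
  exfalso; move: J; rewrite (cs_eq0 CS (p := pf)) ?pf0// mul0r leNgt.
  rewrite mulr_gt0// ltr_wpDl ?mulr_gt0// mulr_ge0 ?(ltW n2)//.
  by rewrite subr0; exact: (cs_ge0 CS).
have pQ : p < Q by lra.
have Q1 : Q < Q + 1 by rewrite ltrDl.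
have sl := supply_slope_le CS pcpf pfp pQ Q1.
have CpfQ : C pf <= C Q by apply: (supply_le CS) => //; lra.
rewrite -invfM ler_pdivlMr ?mulr_gt0//.
have H1 : (G' - p) * (n.+1%:R * (C p - C pf)) <= C Q * (p - pf).
  have : C pf * (p - pf) <= C Q * (p - pf) by rewrite ler_wpM2r//; lra.
  have : 0 <= (G' - p) * (n%:R * (S pf - S p)).
    by rewrite !mulr_ge0 ?(ltW g0) ?(ltW n1) ?(ltW dS).
  by move: J; rewrite mulrDr; lra.
rewrite -(ler_pM2r dp); apply: le_trans H1.
have -> : (G' - p) * ((C (Q + 1) - C Q) * n.+1%:R) * (p - pf) =
  (G' - p) * (n.+1%:R * ((p - pf) * (C (Q + 1) - C Q))) by ring.
rewrite ler_pM2l// ler_pM2l//; lra.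
Qed.

End raise.

(** The deviated RT prices for [p = pf + 1 / (k + 1)] are pointwise eventually
    equal to [ps], because every positive RT price exceeds [pf]. *)
Lemma price_gap_le : (0 < n)%N ->
  \int[P]_w ps w - pf <= C Q / (C (Q + 1) - C Q) / n.+1%:R.
Proof.
move=> n0.
pose p k : R := pf + k.+1%:R^-1.
pose f k w := if p k < ps w then ps w else 0.
have pfp k : pf < p k by rewrite ltrDl invr_gt0.
have fcl k w : rt_clearing C (X w) (p k) (f k w).
  exact (rt_clearing_raise CS pf0 (cl w) (ltW (pfp k))).
have p0 k : 0 <= p k by exact: le_trans pf0 (ltW (pfp k)).
have fint k := rt_price_integrable (p0 k) (fcl k).
have psint := rt_price_integrable pf0 cl.
have fps w : f k w @[k --> \oo] --> ps w.
  apply: cvg_near_cst; have [pspf|pfps] := leP (ps w) pf.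
    near=> k; rewrite /f ifF; last by rewrite ltNge (le_trans pspf (ltW (pfp k))).
    move/rt_clearingE : (cl w); rewrite -(rt_price_gt CS pf0 (cl w))//.
    by rewrite ltNge pspf.
  have e0 : 0 < ps w - pf by rewrite subr_gt0.
  near=> k; rewrite /f ifT// /p.
  have : k.+1%:R^-1 < ps w - pf.
    by near: k; exact: (near_infty_natSinv_lt (PosNum e0)).
  by rewrite ltrBrDl.
have G_cvg : \int[P]_w f k w @[k --> \oo] --> \int[P]_w ps w.
  apply: fine_cvg; rewrite fineK; last exact: integrable_fin_num.
  have [] // := @dominated_convergence _ _ _ P setT measurableT
    (fun k w => (f k w)%:E) (EFin \o ps) (EFin \o ps).
  - by move=> k; exact: measurable_int (fint k).
  - exact: measurable_int psint.
  - by apply: aeW => w _; apply: cvg_EFin; [exact: nearW|exact: fps].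
  - apply: aeW => w k _ /=; rewrite lee_fin /f.
    by have := rt_price_ge0 (cl w); case: ifP => _ ?; rewrite ?normr0// ger0_norm.
have p_cvg : p k @[k --> \oo] --> pf.
  rewrite -[X in _ --> X]addr0; apply: cvgD; first exact: cvg_cst.
  exact: cvg_harmonic.
apply: (cvgr_to_le (cvgB G_cvg p_cvg)); apply: nearW => k.
exact: raised_gap_le.
Unshelve. all: by end_near.
Qed.

End deviations.
End spot.

(** * The limit of many traders *)

Unset Implicit Arguments.
Set Strict Implicit.

Theorem proposition5 (d : measure_display) (Omega : measurableType d)
  (R : realType) (P : probability Omega R)
  (T : set R) (T_itv : is_interval T) (T_bounded : bounded_set T)
  (Dlo Dhi : R) (Dlo_ge0 : 0 <= Dlo) (Dlo_lt_Dhi : Dlo < Dhi)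
  (D : R -> {RV P >-> R})
  (D_bounds : forall t w, T t -> Dlo <= D t w <= Dhi)
  (D_continuous : forall w, {within T, continuous (fun t => D t w)})
  (pc : R) (C : R -> R) (C_supply : conventional_supply pc C)
  (* a sequence of markets, the k-th of which has [NV k] virtual traders *)
  (NV : nat -> nat) (NV_ge2 : forall k, (2 <= NV k)%N)
  (NV_infty : NV k @[k --> \oo] --> \oo)
  (Dl : nat -> R -> R) (B : forall k, 'I_(NV k) -> R -> R)
  (pf : nat -> R -> R) (ps : nat -> R -> Omega -> R)
  (eqm : forall k,
    equilibrium P T C (fun t => D t) (Dl k) (@B k) (pf k) (ps k)) :
  forall t, T t -> price_gap P (pf k t) (ps k t) @[k --> \oo] --> 0%E.
Proof.
move=> t Tt.
have [q q0 Cq] := cs_unlimited C_supply (Dhi + 1).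
(* Supply at [Q] exceeds any demand, so RT prices stay below [Q]; beyond [pc] the
   supply curve is concave, and its slope between [Q] and [Q + 1] can be used. *)
pose Q := Num.max q pc + 1.
have pcQ : pc < Q by rewrite ltr_pwDr// le_max lexx orbT.
have DhiQ : Dhi < C Q.
  have qQ : q <= Q by rewrite ler_wpDr// le_max lexx.
  by have := supply_le C_supply q0 qQ; lra.
have X_bounds w : 0 <= D t w <= Dhi.
  by have /andP[lo ->] := D_bounds t w Tt; rewrite andbT; lra.
have mX : measurable_fun setT (D t) by exact: measurable_funP.
have SE k := equilibrium_spot (eqm k) Tt.
have NV_gt0 k : (0 < NV k)%N by rewrite (leq_trans _ (NV_ge2 k)).
have gapE k : price_gap P (pf k t) (ps k t) =
    (\int[P]_w ps k t w - pf k t)%:E.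
  have [[pf0 _] cl] := se_outcome (SE k).
  exact: (price_gapE C_supply mX X_bounds pcQ DhiQ pf0 cl).
under eq_fun do rewrite gapE.
apply: cvg_EFin; first exact: nearW.
pose K := C Q / (C (Q + 1) - C Q).
apply: (@squeeze_cvgr _ _ _ _ (cst 0) (fun k => K / (NV k).+1%:R)).
- apply: nearW => k /=.
  rewrite (price_gap_ge0 C_supply mX X_bounds pcQ DhiQ (SE k) (Ordinal (NV_gt0 k))).
  exact: (price_gap_le C_supply mX X_bounds pcQ DhiQ (SE k) (NV_gt0 k)).
- exact: cvg_cst.
- rewrite -[X in _ --> X](mulr0 K); apply: cvgM; first exact: cvg_cst.
  exact: (cvg_comp _ _ NV_infty cvg_harmonic).
Qed.
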